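(* Let $n\ge1$, $m\ge1$, let $V_1,\dots,V_{n+1}$ be pairwise disjoint sets each of size $m$, and let $X_{n,m}$ be the simplicial complex on $V_1\cup\dots\cup V_{n+1}$ whose simplices are the sets $\sigma$ with $|\sigma\cap V_i|\le1$ for all $i$. Then for $0\le k\le n-1$, $$h_k(X_{n,m})\ge\frac{\binom{n+1}{k+1}}{\sum_{j=0}^{k+1}\left(\frac{2(m-1)}{m}\right)^j\binom{n-j}{n-k-1}}.$$
   Context: For a finite pure $n$-dimensional complex $X$ with $k$-faces $X(k)$, $f_k(X)=|X(k)|$: for $\sigma\in X(k)$, $c(\sigma)$ is the number of $n$-faces containing $\sigma$ and $w(\sigma)=c(\sigma)/\big(\binom{n+1}{k+1}f_n(X)\big)$. Cochains are $\mathbb{F}_2$-valued; $d_k$ is the coboundary, with the augmented convention ($C^{-1}=\mathbb{F}_2^{\{\emptyset\}}$, $d_{-1}\psi(v)=\psi(\emptyset)$), $B^k(X)=d_{k-1}C^{k-1}(X)$. For $\phi\in C^k(X)$, $\|\phi\|=\sum_{\sigma:\phi(\sigma)\ne0}w(\sigma)$, $\|[\phi]\|=\min_{\psi}\|\phi+d_{k-1}\psi\|$, and $h_k(X)=\min\{\|d_k\phi\|/\|[\phi]\|:\phi\in C^k(X)\setminus B^k(X)\}$. *)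

(* Defs.v *)
From HB Require Import structures.
From mathcomp Require Import all_boot all_order all_algebra.

Set Implicit Arguments.
Unset Strict Implicit.
Unset Printing Implicit Defensive.

Import Order.TTheory GRing.Theory Num.Theory.
Local Open Scope ring_scope.

(* The minimum of F over {x | P x}. The value 0 on an empty range is
   a junk value; both ranges used below are nonempty when X is pure of
   dimension n and k < n. *)
Definition min_over (I : finType) (P : pred I) (F : I -> rat) : rat :=
  if [pick x | P x] is Some x0 then F [arg min_(x < x0 | P x) F x]%O else 0.

Section Complexes.

Variable T : finType.

(* A complex contains the empty simplex, which is its only (-1)-face. *)
Definition is_complex (X : {set {set T}}) : Prop :=
  set0 \in X /\
  forall s t : {set T}, t \in X -> s \subset t -> s \in X.

Definition is_pure (n : nat) (X : {set {set T}}) : Prop :=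
  (forall s, s \in X -> (#|s| <= n.+1)%N) /\
  forall s, s \in X -> exists2 t, t \in X & (s \subset t) && (#|t| == n.+1).

(* Faces and cochains are indexed by the number of vertices, so that the
   augmented convention needs no negative index: X(k) is [face X k.+1] and
   C^k(X) is [cochain X k.+1], with C^{-1}(X) = [cochain X 0]. *)
Definition face (X : {set {set T}}) (i : nat) : finType :=
  {s : {set T} | (s \in X) && (#|s| == i)}.

Definition cochain (X : {set {set T}}) (i : nat) := {ffun face X i -> 'F_2}.

(* d_k is [coboundary] at i = k.+1. *)
Definition coboundary (X : {set {set T}}) (i : nat) (phi : cochain X i) :
    cochain X i.+1 :=
  [ffun t : face X i.+1 =>
     \sum_(s : face X i | val s \subset val t) phi s].

Definition coboundaries (X : {set {set T}}) (i : nat) :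
    {set cochain X i.+1} :=
  [set coboundary psi | psi : cochain X i].

Definition top_degree (n : nat) (X : {set {set T}}) (s : {set T}) : nat :=
  #|[set t : face X n.+1 | s \subset val t]|.

Definition weight (n : nat) (X : {set {set T}}) (s : {set T}) : rat :=
  (top_degree n X s)%:R / ('C(n.+1, #|s|) * #|face X n.+1|)%:R.

Definition cochain_norm (n : nat) (X : {set {set T}}) (i : nat)
    (phi : cochain X i) : rat :=
  \sum_(s : face X i | phi s != 0) weight n X (val s).

Definition class_norm (n : nat) (X : {set {set T}}) (i : nat)
    (phi : cochain X i.+1) : rat :=
  min_over xpredT
    (fun psi : cochain X i => cochain_norm n (phi + coboundary psi)).

(* h_k(X) for X of dimension n. *)
Definition expansion (n : nat) (X : {set {set T}}) (k : nat) : rat :=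
  min_over
    (fun phi : cochain X k.+1 => phi \notin coboundaries X k)
    (fun phi => cochain_norm n (coboundary phi) / class_norm n phi).

Definition partite_complex (n : nat) (V : 'I_n.+1 -> {set T}) :
    {set {set T}} :=
  [set s : {set T} | (s \subset \bigcup_i V i) &&
                     [forall i, #|s :&: V i| <= 1]%N].

Lemma partite_complex_is_complex n (V : 'I_n.+1 -> {set T}) :
  is_complex (partite_complex V).
Proof.
split=> [|s t]; first by rewrite inE sub0set; apply/forallP=> i; rewrite set0I cards0.
rewrite !inE => /andP[tV /forallP t1] st.
rewrite (subset_trans st tV); apply/forallP=> i.
exact: leq_trans (subset_leq_card (setSI _ st)) (t1 i).
Qed.

Lemma partite_complex_is_pure n m (V : 'I_n.+1 -> {set T}) :
  (1 <= m)%N ->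
  (forall i j, i != j -> [disjoint V i & V j]) ->
  (forall i, #|V i| = m) ->
  is_pure n (partite_complex V).
Proof.
move=> m0 dV cV.
have VP i j x : x \in V i -> x \in V j -> i = j.
  move=> xi xj; apply/eqP; apply: contraT => /dV /pred0P /(_ x) /=.
  by rewrite xi xj.
have ext s : s \in partite_complex V ->
    exists2 t, t \in partite_complex V & (s \subset t) && (#|t| == n.+1).
  rewrite inE => /andP[/subsetP sV /forallP s1].
  have ch i : {x | x \in V i & forall y, y \in s -> y \in V i -> y = x}.
    case: (pickP (mem (s :&: V i))) => [x /[!inE] /andP[xs xi]|no].
      exists x => // y ys yi.
      by apply: (card_le1_eqP (s1 i)); rewrite inE ?xs ?ys.
    case: (pickP (mem (V i))) => [x xi|no'].
      by exists x => // y ys yi; move: (no y); rewrite /= inE ys yi.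
    by move: m0; rewrite -(cV i) (eq_card0 no').
  pose f i := s2val (ch i).
  have fV i : f i \in V i := s2valP (ch i).
  have fs i y : y \in s -> y \in V i -> y = f i := s2valP' (ch i) y.
  have f_inj : injective f.
    by move=> i j fij; apply: (VP i j (f i)) => //; rewrite fij.
  exists (f @: [set: 'I_n.+1]).
    rewrite inE; apply/andP; split.
      apply/subsetP=> _ /imsetP[i _ ->]; apply/bigcupP; by exists i.
    apply/forallP=> i; apply/card_le1_eqP=> x y.
    rewrite !inE => /andP[/imsetP[a _ ->] ai] /andP[/imsetP[b _ ->] bi].
    by rewrite (VP _ _ _ ai (fV a)) in bi *; rewrite (VP _ _ _ bi (fV b)).
  rewrite card_imset // cardsT card_ord eqxx andbT.
  apply/subsetP=> y ys; have /bigcupP[i _ yi] := sV _ ys.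
  by rewrite (fs i y ys yi) imset_f.
split=> // s /ext[t _ /andP[st /eqP <-]]; exact: subset_leq_card.
Qed.

End Complexes.

(* Main.v *)
Require Import Defs.
From HB Require Import structures.
From mathcomp Require Import all_boot all_order all_algebra.
From mathcomp Require Import ring zify.

Set Implicit Arguments.
Unset Strict Implicit.
Unset Printing Implicit Defensive.

Import Order.TTheory GRing.Theory Num.Theory.
Local Open Scope ring_scope.

(* Join the factors V_i one at a time. On a single V_i, the augmented chain
   complex of a discrete set, adding the apex y_i is a homotopy between the
   identity and the map v |-> v + y_i; the tensor product of these homotopies,
   for apexes y_0, y_1, ... of distinct colours taken in some order, contracts
   the faces that miss a colour of some y_i. It maps a face sigma, whose colours
   include those of y_0, ..., y_(j-1) but not that of y_j, to
   2^j faces, or to 0 if sigma contains one of y_0, ..., y_(j-1).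
   Hence phi + d psi = cone (d phi) for psi = cone phi, and some choice of the
   colours and of the apexes makes the support of cone (d phi) at most as large
   as its average bound over all choices. *)

(** * Minima over finite ranges and arithmetic in characteristic 2 *)

Lemma min_over_le (I : finType) (P : pred I) (F : I -> rat) x :
  P x -> min_over P F <= F x.
Proof.
move=> Px; rewrite /min_over; case: pickP => [x0 Px0|/(_ x)]; last by rewrite Px.
by case: arg_minP => // y _; apply.
Qed.

Lemma min_over_attained (I : finType) (P : pred I) (F : I -> rat) x :
  P x -> exists2 y, P y & min_over P F = F y.
Proof.
move=> Px; rewrite /min_over; case: pickP => [x0 Px0|/(_ x)]; last by rewrite Px.
by case: arg_minP => // y Py _; exists y.
Qed.

Lemma addF2xx (x : 'F_2) : x + x = 0.
Proof. by have h : 2%N \in [pchar 'F_2] by [exact: pchar_Fp]; apply: addrr_pchar2. Qed.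

Lemma addF2K (x y : 'F_2) : x + (x + y) = y.
Proof. by rewrite addrA addF2xx add0r. Qed.

(** * The coboundary on functions of finite sets *)

Section SetCochains.

Variable T : finType.
Implicit Types (g : {set T} -> 'F_2) (s t : {set T}).

(* Cochains of all degrees are handled at once, as functions on all finite
   sets; this is the coboundary of the full simplex on T. *)
Definition del g t : 'F_2 := \sum_(v in t) g (t :\ v).

Lemma delD g1 g2 t : del (fun s => g1 s + g2 s) t = del g1 t + del g2 t.
Proof. exact: big_split. Qed.

Lemma eq_del g1 g2 t : (forall v, v \in t -> g1 (t :\ v) = g2 (t :\ v)) ->
  del g1 t = del g2 t.
Proof. exact: eq_bigr. Qed.

(** Two vertices can be deleted in either order with the same result. [enum_rank] orders the pairs,
    which splits the double sum into two equal halves that cancel in characteristic 2. *)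
Lemma del_del g t : del (del g) t = 0.
Proof.
pose f v u := g (t :\ v :\ u).
have fC v u : f v u = f u v by rewrite /f !setDDl setUC.
have -> : del (del g) t =
    \sum_(v in t) \sum_(u in t | (enum_rank u < enum_rank v)%N) f v u +
    \sum_(v in t) \sum_(u in t | (enum_rank v < enum_rank u)%N) f v u.
  rewrite -big_split; apply: eq_bigr => v vt /=; rewrite /del.
  rewrite (bigID (fun u => (enum_rank u < enum_rank v)%N)) /=; congr (_ + _).
    apply: eq_bigl => u; rewrite !inE.
    by case: (eqVneq u v) => [->|_] /=; rewrite ?ltnn ?andbF.
  apply: eq_bigl => u; rewrite !inE -leqNgt ltn_neqAle.
  rewrite (inj_eq val_inj) (inj_eq enum_rank_inj) eq_sym.
  by rewrite -andbA andbCA.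
have -> : \sum_(v in t) \sum_(u in t | (enum_rank v < enum_rank u)%N) f v u =
          \sum_(v in t) \sum_(u in t | (enum_rank u < enum_rank v)%N) f v u.
  rewrite (exchange_big_dep (mem t)) /=; last by move=> i j _ /andP[].
  apply: eq_bigr => v vt; rewrite [RHS]big_mkcond [LHS]big_mkcond /=.
  by apply: eq_bigr => u _; rewrite vt /= fC.
exact: addF2xx.
Qed.

(** Link to [coboundary], which sums over subsets with one vertex fewer: deleting a vertex is
    injective on the vertices of [t]. *)
Lemma delE g t : \sum_(s : {set T} | (s \subset t) && (#|s|.+1 == #|t|)) g s = del g t.
Proof.
have -> : del g t = \sum_(s in (fun v => t :\ v) @: t) g s.
  rewrite big_imset // => u v ut vt /setP /(_ u).
  by rewrite !inE eqxx ut andbT; case: eqVneq.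
apply: eq_bigl => s; apply/andP/imsetP => [[st /eqP c]|[v vt ->]]; last first.
  by rewrite subsetDl (cardsD1 v t) vt.
have /cards1P[v tv] : #|t :\: s| == 1%N.
  by rewrite cardsD (setIidPr st) -c subSn // subnn.
exists v; first by have := set11 v; rewrite -tv inE => /andP[].
by rewrite -tv setDDr setDv set0U (setIidPr st).
Qed.

End SetCochains.

(** * Colours and faces of the partite complex *)

Section Partite.

Variables (T : finType) (n m : nat) (V : 'I_n.+1 -> {set T}).
Hypothesis disjV : forall i j : 'I_n.+1, i != j -> [disjoint V i & V j].
Hypothesis cardV : forall i : 'I_n.+1, #|V i| = m.

Implicit Types (g : {set T} -> 'F_2) (s t : {set T}) (c : 'I_n.+1) (y v : T).
Implicit Types (ys : seq ('I_n.+1 * T)) (D : {set 'I_n.+1}).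

Let X := partite_complex V.

(** [hit] and [put] treat a face as a tensor with one factor per colour. [put c y] serves two
    purposes: it adds the apex to a face that misses [c], and moves the vertex of colour [c] to the
    apex otherwise. *)
Definition hit c s := s :&: V c != set0.
Definition put c y s := y |: (s :\: V c).

Lemma hitP c s : reflect (exists2 v, v \in s & v \in V c) (hit c s).
Proof.
apply: (iffP (set0Pn _)) => [[v /setIP[]]|[v vs vc]]; first by exists v.
by exists v; rewrite inE vs.
Qed.

Lemma colour_uniq i j v : v \in V i -> v \in V j -> i = j.
Proof.
move=> vi vj; apply/eqP; apply: contraT => /disjV /pred0P /(_ v) /=.
by rewrite vi vj.
Qed.

Lemma faceS s t : t \in X -> s \subset t -> s \in X.
Proof. exact: (partite_complex_is_complex V).2. Qed.

Lemma vertex_uniq c s u v :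
  s \in X -> u \in s -> v \in s -> u \in V c -> v \in V c -> u = v.
Proof.
rewrite inE => /andP[_ /forallP /(_ c) /card_le1_eqP s1] us vs uc vc.
by apply: s1; rewrite inE ?us ?vs.
Qed.

Lemma vertex_colour s v : s \in X -> v \in s -> exists c, v \in V c.
Proof.
by rewrite inE => /andP[/subsetP sV _] /sV /bigcupP[c _]; exists c.
Qed.

Lemma missD c s : ~~ hit c s -> s :\: V c = s.
Proof. by rewrite negbK => /eqP s0; rewrite -[RHS](setID s (V c)) s0 set0U. Qed.

Lemma hitD1 c s u : s \in X -> u \in s -> u \in V c -> s :\: V c = s :\ u.
Proof.
move=> sX us uc; apply/setP=> v; rewrite !inE.
case vs: (v \in s); rewrite ?andbF ?andbT //; congr (~~ _).
by apply/idP/eqP => [vc|->//]; apply: (vertex_uniq sX vs us vc uc).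
Qed.

Lemma miss_D c s : ~~ hit c (s :\: V c).
Proof. by apply/hitP=> -[v /setDP[_ /negP]]. Qed.

Lemma hit_other c d y s : y \in V c -> d != c -> hit d (y |: s) = hit d s.
Proof.
move=> yc dc; apply/hitP/hitP => -[v vs vd]; exists v => //; last by rewrite setU1r.
by case/setU1P: vs => // vy; move: dc; rewrite (colour_uniq vd (_ : v \in V c)) ?eqxx ?vy.
Qed.

Lemma hit_otherD c d s : d != c -> hit d (s :\: V c) = hit d s.
Proof.
move=> dc; apply/hitP/hitP => -[v vs vd]; exists v => //; first by case/setDP: vs.
by rewrite inE vs andbT; apply: contraNN dc => vc; rewrite (colour_uniq vd vc).
Qed.

Lemma hit_put_other c d y s : y \in V c -> d != c -> hit d (put c y s) = hit d s.
Proof. by move=> yc dc; rewrite /put (hit_other _ yc dc) hit_otherD. Qed.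

Lemma extend_face c y s : s \in X -> ~~ hit c s -> y \in V c -> y |: s \in X.
Proof.
move=> sX sc yc; rewrite inE; apply/andP; split.
  rewrite subUset sub1set; apply/andP; split; first by apply/bigcupP; exists c.
  by move: sX; rewrite inE => /andP[].
apply/forallP=> d; apply/card_le1_eqP=> u v.
have sc' w : w \in s -> w \in V c -> False by move=> ws wc; case/hitP: sc; exists w.
move=> /setIP[/setU1P[uy|us] ud] /setIP[/setU1P[vy|vs] vd]; first by rewrite uy vy.
- by move: ud vd; rewrite uy => yd; rewrite (colour_uniq yd yc) => /(sc' v vs).
- by move: vd ud; rewrite vy => yd; rewrite (colour_uniq yd yc) => /(sc' u us).
- exact: (vertex_uniq sX vs us vd ud).
Qed.

Lemma put_face c y s : s \in X -> y \in V c -> put c y s \in X.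
Proof.
move=> sX; apply: extend_face (miss_D c s).
exact: faceS sX (subsetDl _ _).
Qed.

Lemma notin_miss c y s : ~~ hit c s -> y \in V c -> y \notin s.
Proof. by move=> sc yc; apply: contra sc => ys; apply/hitP; exists y. Qed.

Lemma put_miss c y s : ~~ hit c s -> put c y s = y |: s.
Proof. by rewrite /put => /missD->. Qed.

Lemma putU1 c y v s : v \in V c -> ~~ hit c s -> put c y (v |: s) = y |: s.
Proof.
move=> vc sc; rewrite /put setDUl (missD sc); congr (_ |: _).
by rewrite (_ : [set v] :\: V c = set0) ?set0U //; apply/eqP; rewrite setD_eq0 sub1set.
Qed.

(** Double count of the pairs of a vertex of [s] and its colour: a vertex has exactly one colour,
    and a face has at most one vertex of each colour. *)
Lemma card_face s : s \in X -> #|s| = #|[set c | hit c s]|.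
Proof.
move=> sX; rewrite -!sum1_card.
transitivity (\sum_(v in s) \sum_(c | v \in V c) 1)%N.
  apply: eq_bigr => v vs; have [c vc] := vertex_colour sX vs.
  rewrite (big_pred1 c) // => d; apply/idP/eqP => [vd|->//].
  exact: colour_uniq vd vc.
rewrite (exchange_big_dep predT) //= [RHS]big_mkcond; apply: eq_bigr => c _.
rewrite (eq_bigl (mem (s :&: V c))) => [|v]; last by rewrite !inE.
rewrite sum1_card inE; case: ifPn => [/hitP[v vs vc]|/negPn/eqP->]; last by rewrite cards0.
apply/eqP/cards1P; exists v; apply/setP => u; rewrite !inE.
by apply/andP/eqP => [[us uc]|-> //]; apply: (vertex_uniq sX us vs uc vc).
Qed.

(** * The contraction by apexes and its homotopy identity *)

Fixpoint cone ys g s : 'F_2 :=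
  if ys is (c, y) :: ys' then
    if hit c s then cone ys' g s + cone ys' g (put c y s) else g (put c y s)
  else 0.

(** The error term of the homotopy: the tensor product of the maps v |-> v + y over the colours of
    the apexes. In a single factor this map is 0 on the empty simplex, since coning and then taking
    the boundary gives the empty simplex back; hence the value 0 when [c] is missed. *)
Fixpoint reflection ys g s : 'F_2 :=
  if ys is (c, y) :: ys' then
    if hit c s then reflection ys' g s + reflection ys' g (put c y s) else 0
  else g s.

(* One colour: V c is an augmented discrete set, and coning with apex y is a
   homotopy between the identity and v |-> v + y. *)
Lemma cone1_homotopy c y g s : y \in V c -> s \in X ->
  del (fun r => if hit c r then 0 else g (put c y r)) s +
  (if hit c s then 0 else del g (put c y s)) =
  g s + (if hit c s then g s + g (put c y s) else 0).
Proof.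
move=> yc sX; case: ifPn => [/hitP[u us uc]|sc].
  rewrite addr0 addF2K /del (big_setD1 u us) /=.
  have su := hitD1 sX us uc; have := miss_D c s; rewrite su => sc.
  rewrite (negPf sc) put_miss // /put su big1 ?addr0 // => v /setD1P[vu vs].
  by rewrite ifT //; apply/hitP; exists u; rewrite // !inE eq_sym vu.
have ys := notin_miss sc yc.
rewrite addr0 put_miss // {2}/del big_setU1 //= setU1K //.
rewrite addrCA addrC -[RHS]addr0 addrC; congr (_ + _).
rewrite /del -big_split big1 // => v vs /=.
have scv : ~~ hit c (s :\ v).
  by apply: contra sc => /hitP[w /setD1P[_ ws] wc]; apply/hitP; exists w.
rewrite (negPf scv) put_miss // setDUl.
rewrite (_ : [set y] :\ v = [set y]) ?addF2xx //; apply/setDidPl.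
by rewrite disjoints1 inE; apply: contraNneq ys => ->.
Qed.

(** The map v |-> v + y, with the empty simplex sent to 0, is a chain map of one factor. The faces
    [s] and [put c y s] have the same facet opposite their vertex of colour [c], so these two terms
    of the right side cancel. *)
Lemma reflect1_del c y g s : y \in V c -> s \in X ->
  del (fun r => if hit c r then g r + g (put c y r) else 0) s =
  if hit c s then del g s + del g (put c y s) else 0.
Proof.
move=> yc sX; case: ifPn => [/hitP[u us uc]|sc]; last first.
  rewrite /del big1 // => v vs; rewrite ifN //.
  by apply: contra sc => /hitP[w /setD1P[_ ws] wc]; apply/hitP; exists w.
have su := hitD1 sX us uc; have := miss_D c s; rewrite su => sc.
have ys := notin_miss sc yc.
rewrite /put su /del big_setU1 //= setU1K // !(big_setD1 u us) /= (negPf sc) add0r.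
rewrite addrACA addF2xx add0r -big_split; apply: eq_bigr => v /setD1P[vu vs] /=.
rewrite ifT; last by apply/hitP; exists u; rewrite // !inE eq_sym vu.
have svX : s :\ v \in X by apply: faceS sX (subsetDl _ _).
have usv : u \in s :\ v by rewrite !inE eq_sym vu.
rewrite (hitD1 svX usv uc) setDUl; congr (_ + g _).
rewrite (_ : [set y] :\ v = [set y]); last first.
  apply/setDidPl; rewrite disjoints1 inE; apply: contraNneq ys => ->.
  by rewrite !inE vu.
by rewrite !setDDl [[set u] :|: _]setUC.
Qed.

Definition apexes ys := all (fun p => p.2 \in V p.1) ys.

(* Chain homotopy of a tensor product: cone is the sum over i of
   (reflection in the first i apexes) composed with (coning from the next). *)
Lemma cone_homotopy ys g s : apexes ys -> s \in X ->
  del (cone ys g) s + cone ys (del g) s = g s + reflection ys g s.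
Proof.
elim: ys s => [|[c y] ys IH] s; first by rewrite /= addF2xx addr0 /del big1.
case/andP=> yc ysV sX.
have cE r : cone ((c, y) :: ys) g r =
    (if hit c r then 0 else g (put c y r)) +
    (if hit c r then cone ys g r + cone ys g (put c y r) else 0).
  by rewrite /=; case: ifP; rewrite ?addr0 ?add0r.
rewrite (eq_del (g2 := fun r => (if hit c r then 0 else g (put c y r)) +
  (if hit c r then cone ys g r + cone ys g (put c y r) else 0))); last by move=> v _.
rewrite delD reflect1_del //=.
have := cone1_homotopy g yc sX; have := IH _ ysV sX; have := IH _ ysV (put_face sX yc).
case: ifP => [sc E1 E2|_ _ _]; rewrite !addr0 // => E3.
rewrite addF2K in E3; rewrite E3.
(* The homotopy in colour [c] contributes [g (put c y s)]. It cancels the same term of the induction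
   hypothesis at [put c y s]. *)
rewrite -addrA [in X in _ + X]addrACA E1 E2.
rewrite addrACA !addrA; congr (_ + _ + _).
by rewrite [g _ + g s]addrC -addrA addF2xx addr0.
Qed.

(** Apexes of other colours do not change whether [c] is hit, so the factor [c] is still the empty
    simplex when its own apex is reached, and is sent to 0 there. *)
Lemma reflection_miss ys g s c : apexes ys -> s \in X ->
  c \in map fst ys -> ~~ hit c s -> reflection ys g s = 0.
Proof.
elim: ys s => // [[d y] ys IH] s /= /andP[yd ysV] sX.
rewrite inE => dys sc; case: ifPn => // sd.
have dc : c != d by apply: contraNneq sc => ->.
move: dys; rewrite (negPf dc) /= => dys.
by rewrite !IH ?addr0 // ?put_face // hit_put_other.
Qed.

(** * Counting supports and averaging over apexes *)

Local Open Scope nat_scope.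

(** [D] will hold the colours of the apexes already placed: the recursion of [cone] passes to later
    apexes only on faces that hit all of these. *)
Definition faces i D : {set {set T}} :=
  [set s in X | (#|s| == i) && (D \subset [set c | hit c s])].

Lemma facesE i D s :
  (s \in faces i D) = [&& s \in X, #|s| == i & D \subset [set c | hit c s]].
Proof. by rewrite /faces in_set. Qed.

Lemma facesU1 i c D s : (s \in faces i (c |: D)) = (s \in faces i D) && hit c s.
Proof. by rewrite !inE subUset sub1set inE -!andbA; do !bool_congr; rewrite andbC. Qed.

Lemma faces0 i s : (s \in faces i set0) = (s \in X) && (#|s| == i).
Proof. by rewrite inE sub0set andbT. Qed.

Lemma subset_hit_eq c D r s : c \notin D ->
  (forall d, d != c -> hit d r = hit d s) ->
  (D \subset [set d | hit d r]) = (D \subset [set d | hit d s]).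
Proof.
move=> cD rs; apply/subsetP/subsetP => sub d dD;
  by have := sub d dD; rewrite !inE rs //; apply: contraNneq cD => <-.
Qed.

(** A face that hits [c] splits uniquely into its vertex of colour [c] and the rest; removing [V c]
    inverts the reindexing. *)
Lemma sum_faces_hit i c D (f : {set T} -> nat) : c \notin D ->
  \sum_(s in faces i.+1 (c |: D)) f s =
  \sum_(u in V c) \sum_(r in faces i D | ~~ hit c r) f (u |: r).
Proof.
move=> cD.
transitivity (\sum_(s in faces i.+1 (c |: D)) \sum_(u in V c | u \in s) f s).
  apply: eq_bigr => s; rewrite facesU1 => /andP[/setIdP[sX _] /hitP[u us uc]].
  rewrite (big_pred1 u) // => v; apply/andP/eqP => [[vc vs]|-> //].
  exact: vertex_uniq sX vs us vc uc.
rewrite (exchange_big_dep (mem (V c))) /=; last by move=> s u _ /andP[].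
apply: eq_bigr => u uc.
rewrite (reindex_onto (fun r => u |: r) (fun s => s :\: V c)) /=; last first.
  move=> s; rewrite facesU1 => /and3P[/andP[/setIdP[sX _] _] _ us].
  by rewrite (hitD1 sX us uc) setD1K.
apply: eq_bigl => r; rewrite uc setU11 !andbT facesU1.
have [rc|rc] := boolP (hit c r); last first.
  have -> : hit c (u |: r) by apply/hitP; exists u; rewrite ?setU11.
  have -> : (u |: r) :\: V c = r.
    rewrite setDUl (missD rc) (_ : _ :\: _ = set0) ?set0U //.
    by apply/eqP; rewrite setD_eq0 sub1set.
  rewrite eqxx !andbT !facesE cardsU1 (notin_miss rc uc) eqSS.
  rewrite (subset_hit_eq cD (fun d dc => hit_other r uc dc)); congr (_ && _).
  apply/idP/idP => [urX|rX]; first exact: faceS urX (subsetUr _ _).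
  exact: extend_face rX rc uc.
rewrite [RHS]andbF; apply: contraTF rc => /andP[_ /eqP <-]; exact: miss_D.
Qed.

Lemma sum_distinct_pairs (A : {set T}) (G : T -> nat) :
  \sum_(y in A) \sum_(u in A | u != y) (G u + G y) =
  2 * (#|A| - 1) * \sum_(u in A) G u.
Proof.
have E : \sum_(y in A) \sum_(u in A | u != y) G y = (#|A| - 1) * \sum_(u in A) G u.
  rewrite big_distrr; apply: eq_bigr => y yA /=.
  rewrite (eq_bigl (mem (A :\ y))) => [|u]; last by rewrite !inE andbC.
  by rewrite sum_nat_const (cardsD1 y A) yA add1n subn1.
rewrite -mulnA mul2n -addnn -E.
under eq_bigr do rewrite big_split.
rewrite big_split; congr (_ + _) => /=.
rewrite (exchange_big_dep (mem A)) /=; last by move=> ? ? _ /andP[].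
apply: eq_bigr => y yA; apply: eq_bigl => u.
by rewrite yA eq_sym.
Qed.

(** Faces missing [c] give the first term, as each face hitting [c] is [y |: s] for exactly one such
    pair. On a face [u |: r] with [u] of colour [c], the value is the sum of the values at [u |: r]
    and [y |: r], so its support is bounded by both supports. Over the ordered pairs of distinct [u]
    and [y], each face is counted 2(m-1) times. *)
Lemma cone_step ys g i c D : c \notin D ->
  \sum_(y in V c) \sum_(s in faces i.+1 D) (cone ((c, y) :: ys) g s != 0%R) <=
  \sum_(t in faces i.+2 (c |: D)) (g t != 0%R) +
  2 * (m - 1) * \sum_(s in faces i.+1 (c |: D)) (cone ys g s != 0%R).
Proof.
move=> cD.
pose h s : nat := cone ys g s != 0%R.
rewrite !sum_faces_hit // -(cardV c) -sum_distinct_pairs -big_split.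
apply: leq_sum => y yc; rewrite (bigID (hit c)) /= addnC leq_add //.
  by apply: leq_sum => s /andP[_ sc]; rewrite (negPf sc) put_miss.
rewrite (eq_bigl (fun s => s \in faces i.+1 (c |: D))) => [|s]; last by rewrite facesU1.
(* Faces through the apex [y] are fixed by [put c y], so their two terms cancel; this is why m-1
   appears and not m. *)
rewrite sum_faces_hit // (bigD1 y) //= big1 ?add0n => [|r /andP[_ rc]]; last first.
  have -> : hit c (y |: r) by apply/hitP; exists y; rewrite ?setU11.
  by rewrite putU1 // addF2xx eqxx.
apply: leq_sum => u /andP[uc _]; rewrite -big_split; apply: leq_sum => r /andP[_ rc].
have -> : hit c (u |: r) by apply/hitP; exists u; rewrite ?setU11.
rewrite putU1 //.
by case: (cone ys g (u |: r) =P 0%R) => [->|_]; case: (cone ys g (y |: r) =P 0%R) => [->|_];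
   rewrite ?addr0 ?add0r ?eqxx //; case: (_ == _).
Qed.

Lemma exists_le_mean (I : finType) (A : {set I}) (f : I -> nat) : A != set0 ->
  exists2 x, x \in A & #|A| * f x <= \sum_(x in A) f x.
Proof.
case/set0Pn=> x0 x0A; case: (arg_minnP f x0A) => x xA minx; exists x => //.
by rewrite -sum_nat_const; apply: leq_sum => z /minx.
Qed.

(** A face with [i] vertices hits exactly [i] colours, and those in [D] are among them. *)
Lemma sum_colours i D (f : {set T} -> nat) :
  \sum_(c in ~: D) \sum_(s in faces i (c |: D)) f s =
  (i - #|D|) * \sum_(s in faces i D) f s.
Proof.
under eq_bigr do under eq_bigl do rewrite facesU1.
rewrite (exchange_big_dep (mem (faces i D))) /=; last by move=> c s _ /andP[].
rewrite big_distrr; apply: eq_bigr => s sF /=.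
rewrite (eq_bigl (mem ([set c | hit c s] :\: D))) => [|c]; last by rewrite sF !inE.
move: sF; rewrite facesE => /and3P[sX /eqP <- sD].
by rewrite sum_nat_const cardsD (setIidPr sD) -card_face.
Qed.

(** Numerator of the average bound when [e] apexes remain to be chosen. The denominator is m^e
    C(N+e,e), the number of sets of [e] vertices of distinct colours among N+e free colours. *)
Fixpoint cone_const N e : nat :=
  if e is e'.+1 then m ^ e' * 'C(N + e', e') + 2 * (m - 1) * cone_const N e' else 0.

(** Induction on the number [e] of apexes still to be placed; N+e colours lie outside [D]. Colour
    and apex are each chosen no worse than average. The total of i+2 is the least number of colours
    that no face with i+1 vertices can hit entirely. *)
Lemma exists_apexes g i N e D : 0 < m -> #|D| + e = i.+2 -> N + i.+2 = n.+1 ->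
  exists ys, [/\ apexes ys, uniq (map fst ys), size ys = e,
     {in map fst ys, forall c, c \notin D} &
     m ^ e * 'C(N + e, e) * \sum_(s in faces i.+1 D) (cone ys g s != 0%R)
       <= cone_const N e * \sum_(t in faces i.+2 D) (g t != 0%R)].
Proof.
move=> m0; elim: e D => [|e IH] D De Ni.
  by exists [::]; split=> //=; rewrite big1 ?muln0 // => s _; rewrite eqxx.
have cDC : #|~: D| = (N + e).+1.
  by have := cardsC D; rewrite card_ord; lia.
(* The later apexes are chosen before y, so that they do not depend on it and
   the bound of cone_step can be averaged over y. *)
have [|c] := @exists_le_mean _ (~: D) (fun c => \sum_(s in faces i.+2 (c |: D)) (g s != 0%R)).
  by rewrite -card_gt0 cDC.
rewrite inE sum_colours cDC => cD Bc.
have [|ys [ysV ysu yse ysD A]] := IH (c |: D) _ Ni; first by rewrite cardsU1 cD; lia.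
have [|y yc Ay] := @exists_le_mean _ (V c)
  (fun y => \sum_(s in faces i.+1 D) (cone ((c, y) :: ys) g s != 0%R)).
  by rewrite -card_gt0 cardV.
exists ((c, y) :: ys); split=> /=.
- by rewrite /apexes /= yc.
- by rewrite ysu andbT; apply/negP => /ysD; rewrite setU11.
- by rewrite yse.
- by move=> d; rewrite inE => /predU1P[-> //|/ysD]; rewrite !inE negb_or => /andP[].
set S := (X in _ * X <= _) in Ay *; set B := (X in _ <= _ * X).
have {}Ay := leq_trans Ay (cone_step ys g i cD); rewrite cardV in Ay.
move: A Ay Bc.
set A' := (X in _ * X <= _); set B' := (X in _ <= _ * X) => A Ay Bc.
(* A face counted on the right hits e+1 of the N+e+1 free colours, so the chosen colour retains at
   most that share of the support of [g]. The factor e+1 lets the absorption identity for binomials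
   replace a division. *)
rewrite -(leq_pmul2l (ltn0Sn e)).
have binE : e.+1 * 'C(N + e.+1, e.+1) = (N + e).+1 * 'C(N + e, e).
  by rewrite addnS -mul_bin_diag.
have ie : i.+2 - #|D| = e.+1 by rewrite -De addKn.
rewrite ie in Bc.
have -> : e.+1 * (m ^ e.+1 * 'C(N + e.+1, e.+1) * S) =
          (N + e).+1 * (m ^ e * 'C(N + e, e) * (m * S)).
  by rewrite mulnA [_ * (m ^ _ * _)]mulnCA binE expnS; ring.
apply: (@leq_trans ((N + e).+1 * (cone_const N e.+1 * B'))).
  rewrite leq_mul2l /=; apply: leq_trans (leq_mul (leqnn _) Ay) _.
  rewrite mulnDr /= mulnDl leq_add //.
  by rewrite mulnCA -[leqRHS]mulnA leq_mul2l A orbT.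
by rewrite mulnCA [X in _ <= X]mulnCA leq_mul2l Bc orbT.
Qed.

(** * Uniform weights: from cochain norms to counts of faces *)

Lemma faces_card i D s : s \in faces i D -> #|s| = i.
Proof. by rewrite facesE => /and3P[_ /eqP]. Qed.

Lemma sum_face (R : Type) (idx : R) (op : Monoid.com_law idx) i
    (P : pred {set T}) (F : {set T} -> R) :
  \big[op/idx]_(s : face X i | P (val s)) F (val s) =
  \big[op/idx]_(s in faces i set0 | P s) F s.
Proof.
rewrite [RHS](reindex_omap (val : face X i -> _) insub) => [|s /andP[sF _]].
  by apply: eq_bigl => -[s sP] /=; rewrite faces0 sP insubT /= eqxx andbT.
by rewrite faces0 in sF; rewrite insubT.
Qed.

Lemma top_degree_faces s :
  top_degree n X s = \sum_(t in faces n.+1 set0) (s \subset t).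
Proof.
rewrite /top_degree -sum1dep_card (sum_face _ _ (fun t => s \subset t) (fun=> 1)).
by rewrite big_mkcondr; apply: eq_bigr => t _; case: ifP.
Qed.

Lemma miss_colour s : s \in X -> #|s| < n.+1 -> exists c, ~~ hit c s.
Proof.
move=> sX; rewrite (card_face sX).
case: (pickP (fun c => ~~ hit c s)) => [c sc _|allhit]; first by exists c.
rewrite (eq_card (B := predT)) ?card_ord ?ltnn // => c; rewrite !inE.
by apply: negbFE (allhit c).
Qed.

(** Induction on the number of missed colours: a maximal face containing [s] has exactly one vertex
    of a given missed colour, with [m] candidates. *)
Lemma top_degree_partite s : s \in X -> top_degree n X s = m ^ (n.+1 - #|s|).
Proof.
move En: (n.+1 - #|s|) => j; elim: j s En => [|j IH] s En sX.
  have cs : #|s| = n.+1.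
    apply/eqP; rewrite eqn_leq -(subn_eq0 n.+1) En eqxx andbT.
    by rewrite (card_face sX) -[X in _ <= X]card_ord max_card.
  rewrite top_degree_faces (bigD1 s) /=; last by rewrite faces0 sX cs eqxx.
  rewrite subxx big1 ?addn0 ?expn0 // => t /andP[tF ts].
  apply/eqP; rewrite eqb0; apply: contraNN ts => st.
  by rewrite eq_sym eqEcard st (faces_card tF) cs leqnn.
have lt_s : #|s| < n.+1 by lia.
have [c sc] := miss_colour sX lt_s.
transitivity (\sum_(v in V c) top_degree n X (v |: s)); last first.
  rewrite (eq_bigr (fun=> m ^ j)); first by rewrite sum_nat_const cardV expnS.
  move=> v vc; apply: IH; last exact: extend_face sX sc vc.
  by rewrite cardsU1 (notin_miss sc vc) add1n subnS En.
under [RHS]eq_bigr do rewrite top_degree_faces.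
rewrite top_degree_faces exchange_big; apply: eq_bigr => t.
rewrite faces0 => /andP[tX /eqP ct] /=.
have /hitP[u ut uc] : hit c t.
  apply: contraT => tc; move: (card_face tX); rewrite ct => E.
  have : [set c | hit c t] \subset [set~ c].
    by apply/subsetP => d; rewrite !inE; apply: contraTneq => ->.
  by move/subset_leq_card; rewrite -E cardsC1 card_ord ltnn.
rewrite (bigD1 u uc) /= big1 ?addn0 => [|v /andP[vc vu]].
  by rewrite subUset sub1set ut.
apply/eqP; rewrite eqb0; apply: contraNN vu; rewrite subUset sub1set => /andP[vt _].
by apply/eqP; exact: vertex_uniq tX vt ut vc uc.
Qed.

Local Open Scope ring_scope.

Definition extend i (phi : cochain X i) s : 'F_2 :=
  if insub s is Some s' then phi s' else 0.

Lemma extend_val i (phi : cochain X i) (s : face X i) : extend phi (val s) = phi s.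
Proof. by rewrite /extend valK. Qed.

Lemma face_of i s : s \in faces i set0 -> exists t : face X i, s = val t.
Proof. by rewrite faces0 => sP; exists (Sub s sP). Qed.

Lemma faces_del i s v : s \in faces i.+1 set0 -> v \in s -> s :\ v \in faces i set0.
Proof.
rewrite !faces0 => /andP[sX /eqP cs] vs; rewrite (faceS sX (subsetDl _ _)) /=.
by move: cs; rewrite (cardsD1 v) vs add1n => -[->].
Qed.

Lemma coboundary_del i (phi : cochain X i) (t : face X i.+1) :
  coboundary phi t = del (extend phi) (val t).
Proof.
rewrite ffunE; under eq_bigr do rewrite -extend_val.
rewrite (sum_face _ _ (fun s => s \subset val t)) -delE.
apply: eq_bigl => s; case/andP: (valP t) => tX /eqP ->.
rewrite faces0 eqSS andbC; case st: (s \subset val t) => //=.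
by rewrite (faceS tX st).
Qed.

(** For m > 0 and i at most n+1 this equals 1/(C(n+1,i) m^i), the inverse of the number of faces
    with [i] vertices. *)
Definition unif_weight i : rat :=
  (m ^ (n.+1 - i))%N%:R / ('C(n.+1, i) * m ^ n.+1)%N%:R.

Lemma weight_unif i s : s \in faces i set0 -> weight n X s = unif_weight i.
Proof.
rewrite faces0 => /andP[sX /eqP si]; rewrite /weight top_degree_partite // si.
have -> // : #|face X n.+1| = (m ^ n.+1)%N.
have := top_degree_partite (partite_complex_is_complex V).1.
rewrite cards0 subn0 => <-; rewrite /top_degree -cardsT; congr #|pred_of_set _|.
by apply/setP => t; rewrite !inE sub0set.
Qed.

Lemma norm_unif i (phi : cochain X i) : cochain_norm n phi =
  unif_weight i * (\sum_(s in faces i set0) (extend phi s != 0%R))%N%:R.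
Proof.
rewrite /cochain_norm (eq_bigl (fun s : face X i => extend phi (val s) != 0)); last first.
  by move=> s; rewrite extend_val.
rewrite (sum_face _ _ (fun s => extend phi s != 0)) natr_sum mulr_sumr.
rewrite big_mkcondr; apply: eq_bigr => s sF.
by rewrite (weight_unif sF); case: (_ != 0); rewrite ?mulr1 ?mulr0.
Qed.

Lemma unif_weight_gt0 i : (0 < m)%N -> (i <= n.+1)%N -> 0 < unif_weight i.
Proof.
move=> m0 lei; rewrite divr_gt0 // ltr0n ?muln_gt0 ?expn_gt0 ?m0 //.
by rewrite bin_gt0 lei.
Qed.

Lemma unif_weightS i : (0 < m)%N -> (i <= n)%N ->
  unif_weight i * 'C(n.+1, i)%:R = unif_weight i.+1 * (m * 'C(n.+1, i.+1))%N%:R.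
Proof.
move=> m0 lei; rewrite /unif_weight subSS subSn // expnS !natrM.
have b j : (j <= n.+1)%N -> 'C(n.+1, j)%:R != 0 :> rat.
  by move=> jn; rewrite pnatr_eq0 -lt0n bin_gt0.
have mz : m%:R != 0 :> rat by rewrite pnatr_eq0 -lt0n.
by field; rewrite !natrX ?expf_neq0 ?b //; lia.
Qed.

(** * The bound on the class norm *)

(** The recursion unrolled, with 2(m-1) written as the ratio 2(m-1)/m times [m]. The factor [m] on
    the left avoids the exponent e-1. *)
Lemma cone_constE N e : (0 < m)%N ->
  m%:R * (cone_const N e)%:R = m%:R ^+ e *
    (\sum_(0 <= j < e) (2 * (m%:R - 1) / m%:R) ^+ j * 'C(N + e - j.+1, N)%:R) :> rat.
Proof.
move=> m0; have mz : m%:R != 0 :> rat by rewrite pnatr_eq0 -lt0n.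
elim: e => [|e IH] /=; first by rewrite big_nil !mulr0.
rewrite big_nat_recl // expr0 mul1r addnS [((N + e).+1 - 1)%N]subn1 /= natrD mulrDr.
rewrite natrM [in X in X + _]natrX mulrA -exprS mulrDr; congr (_ + _).
  by rewrite -(bin_sub (leq_addl N e)) addnK.
rewrite natrM mulrCA IH natrM natrB // mulrCA [in RHS]mulr_sumr mulr_sumr mulr_sumr.
apply: eq_bigr => j _; rewrite subSS.
set r := _ / _; have -> : 2 * (m%:R - 1) = r * m%:R by rewrite /r divfK.
by rewrite !exprS; ring.
Qed.

Lemma class_norm_le k (phi : cochain X k.+1) : (0 < m)%N -> (k < n)%N ->
  class_norm n phi * 'C(n.+1, k.+1)%:R <=
  (\sum_(0 <= j < k.+2)
       (2 * (m%:R - 1) / m%:R) ^+ j * 'C(n - j, n - k - 1)%:R) *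
  cochain_norm n (coboundary phi).
Proof.
move=> m0 kn; set S := \sum_(0 <= j < k.+2) _.
pose g := extend phi; pose N := (n - k - 1)%N.
have NkS : (N + k.+2 = n.+1)%N by rewrite /N; lia.
have [|ys [ysV ysu yse _ count_le]] := exists_apexes (del g) (i := k) (e := k.+2)
  (D := set0) m0 _ NkS; first by rewrite cards0.
(* The cone of [phi] itself: the homotopy identity turns [phi] + d psi into the cone of d phi
   wherever the reflection vanishes. *)
pose psi : cochain X k := [ffun s => cone ys g (val s)].
have psiE s : s \in faces k.+1 set0 -> extend (phi + coboundary psi) s = cone ys (del g) s.
  move=> sF; move: (sF); rewrite faces0 => /andP[sX /eqP cs].
  have -> : extend (phi + coboundary psi) s = g s + del (cone ys g) s.
    have [s' s'E] := face_of sF; rewrite s'E extend_val ffunE -extend_val.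
    rewrite coboundary_del; congr (_ + _); apply: eq_del => v vs.
    rewrite -s'E in vs *; have [r ->] := face_of (faces_del sF vs).
    by rewrite extend_val ffunE.
  (* Pigeonhole: the k+2 apexes have distinct colours and [s] has only k+1 vertices, so some apex
     colour is missed and the reflection vanishes at [s]. *)
  have [c] : exists2 c, c \in map fst ys & ~~ hit c s.
    apply/exists_inP; rewrite -negb_forall_in; apply/negP => /forall_inP allhit.
    have : [set c in map fst ys] \subset [set c | hit c s].
      by apply/subsetP => c; rewrite !inE => /allhit.
    move/subset_leq_card; rewrite -card_face // cs cardsE (card_uniqP ysu) size_map yse.
    by rewrite ltnn.
  move=> cys sc; have := cone_homotopy g ysV sX.
  rewrite (reflection_miss _ ysV sX cys sc) addr0 => <-.
  by rewrite addrAC addF2xx add0r.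
have norm_le : class_norm n phi <= unif_weight k.+1 *
    (\sum_(s in faces k.+1 set0) (cone ys (del g) s != 0%R))%N%:R.
  apply: le_trans (min_over_le _ (isT : xpredT psi)) _; rewrite norm_unif.
  by rewrite (eq_bigr _ (fun s sF => congr1 (fun x => nat_of_bool (x != 0)) (psiE s sF))).
have cobE : cochain_norm n (coboundary phi) = unif_weight k.+2 *
    (\sum_(t in faces k.+2 set0) (del g t != 0%R))%N%:R.
  rewrite norm_unif; congr (_ * _%:R); apply: eq_bigr => _ /face_of[t ->].
  by rewrite extend_val coboundary_del.
move: norm_le count_le; rewrite cobE.
set A := (\sum_(s in faces k.+1 _) _)%N; set B := (\sum_(s in faces k.+2 _) _)%N.
move=> norm_le count_le.
have SE : m%:R * (cone_const N k.+2)%:R = m%:R ^+ k.+2 * S :> rat.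
  rewrite cone_constE //; congr (_ * _); apply: eq_big_nat => j /andP[_ jk].
  by congr (_ * _%:R); rewrite NkS subSS.
(* Multiplying the count by [m] turns its constant into m^(k+2) [S], and m^(k+2) cancels. *)
have countQ : (m * 'C(n.+1, k.+2))%N%:R * A%:R <= S * B%:R :> rat.
  have mk0 : 0 < m%:R ^+ k.+2 :> rat by rewrite exprn_gt0 // ltr0n.
  rewrite -(ler_pM2l mk0) [leRHS]mulrA -SE -natrX -!natrM ler_nat.
  rewrite NkS in count_le; rewrite -[leqRHS]mulnA.
  rewrite -[(m * _ * A)%N]mulnA mulnCA leq_mul2l mulnA.
  by rewrite count_le orbT.
apply: (@le_trans _ _ (unif_weight k.+1 * A%:R * 'C(n.+1, k.+1)%:R)).
  by rewrite ler_wpM2r.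
rewrite mulrAC unif_weightS // mulrCA -mulrA ler_pM2l //.
exact: unif_weight_gt0.
Qed.

(** * Positive class norms and a nonempty range for the expansion *)

(** The minimum is attained at some [psi]. All weights are positive, so a zero norm would force
    [phi] + d psi = 0, making [phi] a coboundary. *)
Lemma class_norm_gt0 k (phi : cochain X k.+1) : (0 < m)%N -> (k < n)%N ->
  phi \notin coboundaries X k -> 0 < class_norm n phi.
Proof.
move=> m0 kn phiB; rewrite /class_norm.
have [//|psi _ ->] := @min_over_attained (cochain X k) xpredT
  (fun psi => cochain_norm n (phi + coboundary psi)) 0.
rewrite norm_unif pmulr_rgt0; last by apply: unif_weight_gt0 => //; exact: ltnW.
rewrite ltr0n lt0n.
apply: contra phiB; rewrite sum_nat_eq0 => /forall_inP z; apply/imsetP; exists psi => //.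
apply/ffunP => s; apply/eqP; rewrite -subr_eq0.
have := z (val s); rewrite faces0 extend_val (valP s) => /(_ isT).
rewrite eqb0 negbK ffunE => /eqP h; rewrite -h; apply/eqP; congr (_ + _).
by apply/eqP; rewrite eq_sym -addr_eq0 addF2xx.
Qed.

Lemma exists_face i : (0 < m)%N -> (i <= n.+1)%N -> exists s, s \in faces i set0.
Proof.
move=> m0; elim: i => [_|i IH ltin].
  by exists set0; rewrite faces0 cards0 eqxx (partite_complex_is_complex V).1.
have [s] := IH (ltnW ltin); rewrite faces0 => /andP[sX /eqP cs].
have [|c sc] := miss_colour sX; first by rewrite cs.
have /card_gt0P[y yc] : (0 < #|V c|)%N by rewrite cardV.
exists (y |: s); rewrite faces0 (extend_face sX sc yc).
by rewrite cardsU1 (notin_miss sc yc) cs eqxx.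
Qed.

(** Ensures that the expansion is a true minimum and not the default 0. The witness is the indicator
    of one facet of a (k+1)-face [t]: its coboundary is 1 at [t], while d d = 0. *)
Lemma exists_noncoboundary k : (0 < m)%N -> (k < n)%N ->
  exists phi : cochain X k.+1, phi \notin coboundaries X k.
Proof.
move=> m0 kn; have [t tF] := exists_face m0 (kn : (k.+2 <= n.+1)%N).
have /card_gt0P[y yt] : (0 < #|t|)%N by rewrite (faces_card tF).
pose phi : cochain X k.+1 := [ffun r => (val r == t :\ y)%:R].
exists phi; apply/imsetP => -[psi _ phiE].
have : del (extend phi) t = 0.
  rewrite -(del_del (extend psi) t); apply: eq_del => v vt.
  have [r ->] := face_of (faces_del tF vt).
  by rewrite extend_val phiE coboundary_del.
have phiE' v : v \in t -> extend phi (t :\ v) = (v == y)%:R.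
  move=> vt; have [r rE] := face_of (faces_del tF vt).
  rewrite rE extend_val ffunE -rE; congr (nat_of_bool _)%:R.
  apply/eqP/eqP => [/setP /(_ v)|-> //].
  by rewrite !inE eqxx vt /= andbT; case: eqVneq.
rewrite /del (bigD1 y yt) /= phiE' // eqxx big1 ?addr0 => [/eqP|v /andP[vt vy]].
  by rewrite oner_eq0.
by rewrite phiE' // (negPf vy).
Qed.

End Partite.

Theorem theorem3p3 (T : finType) (n m k : nat) (V : 'I_n.+1 -> {set T})
    (hn : (1 <= n)%N) (hm : (1 <= m)%N)
    (hdisj : forall i j : 'I_n.+1, i != j -> [disjoint V i & V j])
    (hcard : forall i : 'I_n.+1, #|V i| = m)
    (hk : (k <= n - 1)%N) :
  'C(n.+1, k.+1)%:R /
    (\sum_(0 <= j < k.+2)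
       (2 * (m%:R - 1) / m%:R) ^+ j * 'C(n - j, n - k - 1)%:R)
  <= expansion n (partite_complex V) k.
Proof.
have kn : (k < n)%N by lia.
have [phi0 phi0B] := exists_noncoboundary hdisj hcard hm kn.
rewrite /expansion.
have [phi phiB ->] := @min_over_attained (cochain (partite_complex V) k.+1)
  (fun phi => phi \notin coboundaries (partite_complex V) k)
  (fun phi => cochain_norm n (coboundary phi) / class_norm n phi) _ phi0B.
rewrite ler_pdivlMr ?(class_norm_gt0 hdisj hcard) // mulrAC ler_pdivrMr.
  by rewrite mulrC [leRHS]mulrC; exact: class_norm_le.
(* The denominator is positive through its term j = 0, the binomial C(n, n-k-1); the other terms are
   nonnegative because m is at least 1. *)
rewrite big_nat_recl // ltr_wpDr //; last first.
  by rewrite expr0 mul1r ltr0n bin_gt0; lia.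
apply: sumr_ge0 => j _; rewrite mulr_ge0 // exprn_ge0 // divr_ge0 // mulr_ge0 //.
by rewrite subr_ge0 ler1n.
Qed.
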